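(* Let $R=K[x,y,z,u]$ be the polynomial ring over a field $K$. For every non-negative integer $c$ there exist (monomial) ideals $I$ and $J$ of $R$ such that $\operatorname{astab}(I)-\operatorname{dstab}(I)\geq c$ and $\operatorname{dstab}(J)-\operatorname{astab}(J)\geq c$.
   Context: For an ideal $I$: $\operatorname{astab}(I)$ is the smallest positive integer $k_0$ with $\operatorname{Ass}(R/I^k)=\operatorname{Ass}(R/I^{k_0})$ for all $k\geq k_0$; $\operatorname{dstab}(I)$ is the smallest positive integer $k_0$ with $\operatorname{depth} R/I^k=\operatorname{depth} R/I^{k_0}$ for all $k\geq k_0$. Depth is with respect to the graded maximal ideal. *)

(* Defs.v *)
From HB Require Import structures.
From mathcomp Require Import all_boot all_order all_algebra.
From mathcomp Require Import mpoly.
Set Implicit Arguments. Unset Strict Implicit. Unset Printing Implicit Defensive.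
Import GRing.Theory.
Local Open Scope ring_scope.

Section Ideals.
Variable K : fieldType.
Local Notation R := {mpoly K[4]}.

Definition is_ideal (I : R -> Prop) : Prop :=
  [/\ I 0, (forall a b, I a -> I b -> I (a + b)) & (forall r a, I a -> I (r * a))].

Definition gen_ideal (S : R -> Prop) : R -> Prop :=
  fun f => forall J, is_ideal J -> (forall g, S g -> J g) -> J f.

Definition unit_ideal : R -> Prop := fun _ => True.

Definition prod_ideal (I J : R -> Prop) : R -> Prop :=
  gen_ideal (fun f => exists a b, [/\ I a, J b & f = a * b]).

Fixpoint pow_ideal (I : R -> Prop) (k : nat) : R -> Prop :=
  match k with
  | 0%N => unit_ideal
  | k'.+1 => prod_ideal I (pow_ideal I k')
  end.

Definition is_prime_ideal (P : R -> Prop) : Prop :=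
  [/\ is_ideal P, ~ P 1 & (forall a b, P (a * b) -> P a \/ P b)].

Definition is_monomial_ideal (I : R -> Prop) : Prop :=
  is_ideal I /\ (forall f, I f -> forall m, m \in msupp f -> I 'X_[m]).

Definition Ass (L : R -> Prop) : (R -> Prop) -> Prop :=
  fun P => is_prime_ideal P /\ exists f : R, forall g, P g <-> L (f * g).

Definition max_graded : R -> Prop :=
  gen_ideal (fun f => exists i : 'I_4, f = 'X_i).

Definition ext_ideal (L : R -> Prop) (s : seq R) : R -> Prop :=
  gen_ideal (fun f => L f \/ f \in s).

Definition regular_seq (L : R -> Prop) (s : seq R) : Prop :=
  [/\ (forall f, f \in s -> max_graded f),
      (forall i, (i < size s)%N -> forall g,
          ext_ideal L (take i s) (nth 0 s i * g) -> ext_ideal L (take i s) g)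
    & ~ ext_ideal L s 1].

Definition has_depth (L : R -> Prop) (d : nat) : Prop :=
  (exists s, regular_seq L s /\ size s = d) /\
  (forall s, regular_seq L s -> (size s <= d)%N).

Definition Ass_stable_from (I : R -> Prop) (k0 : nat) : Prop :=
  forall k, (k0 <= k)%N -> forall P, Ass (pow_ideal I k) P <-> Ass (pow_ideal I k0) P.

Definition depth_stable_from (I : R -> Prop) (k0 : nat) : Prop :=
  forall k, (k0 <= k)%N -> forall d, has_depth (pow_ideal I k) d <-> has_depth (pow_ideal I k0) d.

Definition is_astab (I : R -> Prop) (a : nat) : Prop :=
  [/\ (0 < a)%N, Ass_stable_from I a &
      (forall a', (0 < a')%N -> (a' < a)%N -> ~ Ass_stable_from I a')].

Definition is_dstab (I : R -> Prop) (d : nat) : Prop :=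
  [/\ (0 < d)%N, depth_stable_from I d &
      (forall d', (0 < d')%N -> (d' < d)%N -> ~ depth_stable_from I d')].

End Ideals.

(* Main.v *)
From Stdlib Require Import Classical ClassicalEpsilon FunctionalExtensionality PropExtensionality.
Require Import Defs.
From mathcomp Require Import all_boot all_order all_algebra.
From mathcomp Require Import mpoly zify ring.
Set Implicit Arguments. Unset Strict Implicit. Unset Printing Implicit Defensive.

(** Let n = N + 1 be large.  The k-fold sums of {0, 1, n - 1, n} fill [0, kn]
    exactly when k >= n - 2, so that the powers of a monomial ideal can have
    gaps which disappear late.

    I = (x^n, x^(n-1) y, y^n, u x y^(n-1)) + (x, y, z) (x, y)^n.  The monomial
    x y^(kn-1) shows that the maximal ideal is associated to every I^k, hence
    depth R/I^k = 0 for all k, while (x, y, z) is associated to I^k exactly as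
    long as there is a gap.

    J = (s^n, s^(n-1) t, s t^(n-1), t^n) + (x, z) (y, u) (s, t)^n with s = xy and
    t = zu.  All J^k have the associated primes (x, z), (x, u), (y, z), (y, u).
    A gap i gives a monomial w = s^i t^(kn-i) with w (x, z) (y, u) in J^k, which
    disconnects the punctured spectrum, so that depth R/J^k < 2; without gaps
    J^k = (s, t)^(kn) has depth 2. *)

(** * Monomial ideals as sets of exponents *)

Section MonomialIdeals.
Import Order.TTheory GRing.Theory.
Local Open Scope ring_scope.
Variable K : fieldType.
Local Notation R := {mpoly K[4]}.
Local Notation Mon := 'X_{1..4}.
Implicit Types (L : R -> Prop) (A B : Mon -> Prop) (f g h : R) (m v : Mon) (S : {set 'I_4}).

Lemma pred_ext T (P Q : T -> Prop) : (forall x, P x <-> Q x) -> P = Q.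
Proof.
by move=> PQ; apply: functional_extensionality => x;
   apply: propositional_extensionality.
Qed.

Lemma ideal_opp L f : is_ideal L -> L f -> L (- f).
Proof. by case=> _ _ mulL Lf; rewrite -mulN1r; apply: mulL. Qed.

Lemma ideal_sub L f g : is_ideal L -> L f -> L g -> L (f - g).
Proof. by move=> idL Lf Lg; case: (idL) => _ addL _; apply: addL => //; apply: ideal_opp. Qed.

Lemma ideal_sum L (I : eqType) (r : seq I) (F : I -> R) :
  is_ideal L -> (forall i, i \in r -> L (F i)) -> L (\sum_(i <- r) F i).
Proof. by case=> L0 addL _ LF; rewrite big_seq; apply: big_ind. Qed.

Lemma gen_idealP (T : R -> Prop) : is_ideal (gen_ideal T).
Proof.
split=> [J [] //|f g Tf Tg J idJ TJ|r f Tf J idJ TJ]; have [_ addJ mulJ] := idJ.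
  by apply: addJ; [apply: Tf | apply: Tg].
by apply: mulJ; apply: Tf.
Qed.

Definition upset A := forall m v, A m -> A (m + v)%MM.

Definition mon_ideal A : R -> Prop := fun f => forall m, m \in msupp f -> A m.

Lemma mon_idealP A : upset A -> is_ideal (mon_ideal A).
Proof.
move=> upA; split=> [m|f g Af Ag m|r f Af m]; first by rewrite msupp0.
  by move/msuppD_le; rewrite mem_cat => /orP[]; [apply: Af | apply: Ag].
move/msuppM_le/allpairsP => [[m1 m2] /= [_ /Af Am2 ->]].
by rewrite addmC; apply: upA.
Qed.

Lemma mon_idealX A m : mon_ideal A 'X_[m] <-> A m.
Proof.
by split=> [|Am v]; [apply; rewrite msuppX mem_head | rewrite msuppX inE => /eqP->].
Qed.

Lemma mon_idealXM A m f :
  mon_ideal A ('X_[m] * f) <-> (forall v, v \in msupp f -> A (m + v)%MM).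
Proof.
rewrite mulrC; split=> Af v; last first.
  by rewrite (perm_mem (msuppMX f m)) => /mapP[v' /Af Av' ->].
by move=> fv; apply: Af; rewrite (perm_mem (msuppMX f m)) map_f.
Qed.

Lemma ideal_monE L f : is_ideal L -> (forall m, m \in msupp f -> L 'X_[m]) -> L f.
Proof.
move=> idL Lf; rewrite [f]mpolyE; apply: ideal_sum => // m /Lf.
by rewrite -mul_mpolyC; case: idL => _ _; apply.
Qed.

Lemma mon_ideal_monomial A : upset A -> is_monomial_ideal (mon_ideal A).
Proof.
by move=> upA; split=> [|f Af m /Af Am]; [apply: mon_idealP | apply/mon_idealX].
Qed.

Definition addset A B : Mon -> Prop :=
  fun m => exists m1 m2, [/\ A m1, B m2 & m = (m1 + m2)%MM].

Lemma prod_mon_ideal A B : upset A ->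
  prod_ideal (mon_ideal A) (mon_ideal B) = mon_ideal (addset A B).
Proof.
move=> upA; apply: pred_ext => f; split=> [|ABf].
  apply=> [|g [a [b [Aa Bb ->]]] m]; last first.
    move/msuppM_le/allpairsP => [[m1 m2] /= [/Aa Am1 /Bb Bm2 ->]].
    by exists m1, m2.
  apply: mon_idealP => m v [m1 [m2 [Am1 Bm2 ->]]].
  exists (m1 + v)%MM, m2; split=> //; first exact: upA.
  by rewrite -!addmA; congr (_ + _)%MM; rewrite addmC.
apply: ideal_monE; first exact: gen_idealP.
move=> m /ABf [m1 [m2 [Am1 Bm2 ->]]] J idJ; apply.
by exists 'X_[m1], 'X_[m2]; rewrite mpolyXD; split=> //; apply/mon_idealX.
Qed.

(** Reduces the computation of all powers to a recurrence between explicit sets of exponents. *)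
Lemma pow_mon_ideal (A : nat -> Mon -> Prop) k :
  upset (A 1%N) -> (forall m, A 0%N m) ->
  (forall j m, A j.+1 m <-> addset (A 1%N) (A j) m) ->
  pow_ideal (mon_ideal (A 1%N)) k = mon_ideal (A k).
Proof.
move=> upA A0 AS; elim: k => [|k IH] /=; first by apply: pred_ext => f; split=> // _ m _; apply: A0.
by rewrite IH prod_mon_ideal //; congr mon_ideal; apply: pred_ext => m; rewrite AS.
Qed.

(** * Associated primes of monomial ideals *)

(** [mon_ideal (meets S)] is the prime ideal generated by the variables in [S]. *)
Definition meets S : Mon -> Prop := fun m => exists2 i, i \in S & (0 < m i)%N.

(** For an upset [A]: the colon ideal of [mon_ideal A] by the monomial [m] is the prime generated by
    the variables in [S]. *)
Definition witness A S m :=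
  (forall i, i \in S -> A (m + U_(i))%MM) /\
  (forall v, (forall i, i \in S -> v i = 0%N) -> ~ A (m + v)%MM).

Lemma meetsN S m : ~ meets S m <-> (forall i, i \in S -> m i = 0%N).
Proof.
split=> [nSm i Si | m0 [i /m0 ->] //].
by case: (posnP (m i)) => // mi; case: nSm; exists i.
Qed.

Lemma meets_upset S : upset (meets S).
Proof. by move=> m v [i Si mi]; exists i => //; rewrite mnmDE; lia. Qed.

Lemma split_supp (D : Mon -> Prop) f :
  exists f1 f2, [/\ f = f1 + f2, mon_ideal D f1 & mon_ideal (fun m => ~ D m) f2].
Proof.
elim/mpolyind: f => [|c m f _ c0 [f1 [f2 [-> Df1 Df2]]]].
  by exists 0, 0; split; rewrite ?addr0 // => m; rewrite msupp0.
have addX (E : Mon -> Prop) g : E m -> mon_ideal E g -> mon_ideal E (c *: 'X_[m] + g).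
  move=> Em Eg v /msuppD_le; rewrite mem_cat msuppMCX // inE.
  by case/orP => [/eqP-> | /Eg].
case: (classic (D m)) => Dm.
  by exists (c *: 'X_[m] + f1), f2; rewrite addrA; split=> //; apply: addX.
by exists f1, (c *: 'X_[m] + f2); rewrite addrCA; split=> //; apply: addX.
Qed.

(** Modulo the ideal, each factor may be replaced by its part free of the variables in [S]. If both
    parts are nonzero, their leading monomials multiply to a monomial of the product free of [S]. *)
Lemma meets_prime S : is_prime_ideal (mon_ideal (meets S)).
Proof.
have idS := mon_idealP (@meets_upset S).
split=> // [S1|a b Sab].
  by have [|i _] := S1 0%MM; rewrite ?msupp1 ?inE // mnm0E.
have [a1 [a2 [Da Sa1 Sa2]]] := split_supp (meets S) a.
have [b1 [b2 [Db Sb1 Sb2]]] := split_supp (meets S) b.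
case: (eqVneq a2 0) => [a20|a2N0]; first by left; rewrite Da a20 addr0.
case: (eqVneq b2 0) => [b20|b2N0]; first by right; rewrite Db b20 addr0.
have: mon_ideal (meets S) (a2 * b2).
  have ->: a2 * b2 = a * b - (b * a1 + a2 * b1) by rewrite Da Db; ring.
  by have [_ addS mulS] := idS; apply: (ideal_sub idS) => //; apply: addS; apply: mulS.
move/(_ _ (mlead_supp (mulf_neq0 a2N0 b2N0))); rewrite mleadM // => -[i Si].
rewrite mnmDE addn_gt0.
by case/orP => mi; [case: (Sa2 _ (mlead_supp a2N0)) | case: (Sb2 _ (mlead_supp b2N0))]; exists i.
Qed.

Lemma mlead_tail f : let f' := f - f@_(mlead f) *: 'X_[mlead f] in
  f' != 0 -> (mlead f' < mlead f)%O.
Proof.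
move=> f' f'0; rewrite lt_neqAle.
have -> : (mlead f' <= mlead f)%O.
  apply: le_trans (mleadB_le _ _) _; rewrite leUx lexx /=.
  by apply: le_trans (mleadZ_le _ _) _; rewrite mleadXm.
rewrite andbT; apply: contraL (mlead_supp f'0) => /eqP->.
by rewrite -mcoeff_eq0 mcoeffB mcoeffZ mcoeffX eqxx mulr1 subrr.
Qed.

(* Cancelling leading terms one at a time: multiplying by the leading monomial
   of g kills one term of f modulo the ideal. *)
Lemma mlead_power_colon A f g m : upset A -> g != 0 ->
  mon_ideal A (g * ('X_[m] * f)) ->
  exists k, mon_ideal A ('X_[mlead g] ^+ k * ('X_[m] * f)).
Proof.
move=> upA g0; have idA := mon_idealP upA; case: (idA) => A0 addA mulA.
elim/mleadrect: f m => f IH m Agf.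
case: (eqVneq f 0) => [->|f0]; first by exists 0%N; rewrite !mulr0.
set l := mlead f; set u := mlead g.
have Aum : A (u + (m + l))%MM.
  have mf0 : 'X_[m] * f != 0 by rewrite mulf_neq0 // -msupp_eq0 msuppX.
  have := Agf _ (mlead_supp (mulf_neq0 g0 mf0)).
  by rewrite mleadM // mleadM ?mleadXm // -msupp_eq0 msuppX.
pose t := f@_l *: 'X_[l]; pose f' := f - t.
have At : mon_ideal A ('X_[u] * ('X_[m] * t)).
  by rewrite /t -!scalerAr -!mpolyXD -mul_mpolyC; apply/mulA/mon_idealX.
(* The factor [X_[u]] sends the leading term [t] into the ideal and is then absorbed into [m], which
   is why [m] varies in the induction. *)
have [k Ak] : exists k, mon_ideal A ('X_[u] ^+ k * ('X_[m + u] * f')).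
  case: (eqVneq f' 0) => [->|f'0]; first by exists 0%N; rewrite !mulr0.
  apply: IH; first exact: mlead_tail.
  have ->: g * ('X_[m + u] * f') = 'X_[u] * (g * ('X_[m] * f)) - g * ('X_[u] * ('X_[m] * t)).
    by rewrite mpolyXD /f'; ring.
  by apply: (ideal_sub idA); apply: mulA.
exists k.+1.
have ->: 'X_[u] ^+ k.+1 * ('X_[m] * f) =
   'X_[u] ^+ k * ('X_[m + u] * f') + 'X_[u] ^+ k * ('X_[u] * ('X_[m] * t)).
  by rewrite mpolyXD /f' exprS; ring.
by apply: addA => //; apply: mulA.
Qed.

Lemma prime_exp L f k : is_prime_ideal L -> L (f ^+ k) -> L f.
Proof. by move=> [_ L1 pL]; elim: k => [|k IH]; rewrite ?expr0 // exprS => /pL[]. Qed.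

Lemma prime_monP L m : is_prime_ideal L ->
  L 'X_[m] <-> exists2 i, L 'X_i & (0 < m i)%N.
Proof.
move=> prL; have [[_ _ mulL] L1 pL] := prL; split=> [|[i Li mi]]; last first.
  have ->: m = ((m - U_(i)) + U_(i))%MM.
    by apply/mnmP => j; rewrite mnmDE mnmBE mnm1E; case: eqP => [<-|_]; lia.
  by rewrite mpolyXD; apply: mulL.
rewrite mpolyXE_id => Lm; apply: NNPP => nL; move: Lm.
apply: (big_ind (fun f => ~ L f)) => // [a b La Lb /pL[]//|i _].
by case: (posnP (m i)) => [->//|mi] /(prime_exp prL) Li; apply: nL; exists i.
Qed.

Lemma classical_set (Q : 'I_4 -> Prop) : exists S, forall i, i \in S <-> Q i.
Proof.
exists [set i | if excluded_middle_informative (Q i) then true else false] => i.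
by rewrite inE; case: excluded_middle_informative.
Qed.

(** By [mlead_power_colon], leading monomials of elements of [P] lie in [P], so [P] is generated by
    variables. Being prime, [P] contains, hence equals, the colon ideal by a single monomial of
    [f]. *)
Lemma Ass_monP A P : upset A ->
  Ass (mon_ideal A) P <->
  exists S, P = mon_ideal (meets S) /\ exists m, witness A S m.
Proof.
move=> upA; have idA := mon_idealP upA; split; last first.
  move=> [S [-> [m [Sm nSm]]]]; split; first exact: meets_prime.
  exists 'X_[m] => g; rewrite mon_idealXM; split=> Sg v gv.
    have [i /Sm Ami vi] := Sg v gv.
    have ->: (m + v = (m + U_(i)) + (v - U_(i)))%MM; last exact: upA.
    apply/mnmP => j; rewrite !mnmDE mnmBE mnm1E; case: eqP => [<-|_]; lia.
  by apply: NNPP => /meetsN nSv; apply: (nSm v) => //; apply: Sg.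
case=> prP [f Pf]; have [[P0 addP mulP] P1 pP] := prP.
have [S SP] := classical_set (fun i => P 'X_i).
have monP g : P g -> forall m, m \in msupp g -> P 'X_[m].
  elim/mleadrect: g => g IH Pg; case: (eqVneq g 0) => [->|g0] m.
    by rewrite msupp0.
  have Pl : P 'X_[mlead g].
    have := Pg; rewrite Pf mulrC -[f]mul1r -mpolyX0.
    case/(mlead_power_colon upA g0) => k.
    by rewrite mpolyX0 mul1r mulrC -Pf => /(prime_exp prP).
  pose g' := g - g@_(mlead g) *: 'X_[mlead g].
  have Pg' : P g' by apply: (ideal_sub (And3 P0 addP mulP)) => //; rewrite -mul_mpolyC; apply: mulP.
  case: (eqVneq m (mlead g)) => [->//|ml] gm.
  have gm' : m \in msupp g'.
    by move: gm; rewrite !mcoeff_msupp mcoeffB mcoeffZ mcoeffX (eq_sym _ m) (negPf ml) mulr0 subr0.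
  apply: (IH g') => //; apply: mlead_tail.
  by apply/eqP => g'0; move: gm'; rewrite /g' g'0 msupp0.
have PS m : P 'X_[m] <-> meets S m.
  by rewrite prime_monP //; split=> -[i /SP Si mi]; exists i.
exists S; split.
  apply: pred_ext => g; split=> [Pg m /(monP _ Pg) /PS //|Sg].
  by apply: ideal_monE => // m /Sg /PS.
have [m [fm Pm]] : exists m, m \in msupp f /\ forall g, mon_ideal A ('X_[m] * g) -> P g.
  apply: NNPP => noM.
  (* If each monomial of [f] has a multiplier outside [P] sending it into the ideal, the product of
     these multipliers is outside [P] and sends [f] into the ideal. *)
  have [g [nPg gA]] : exists g, ~ P g /\ forall m, m \in msupp f -> mon_ideal A ('X_[m] * g).
    have : forall m, m \in msupp f -> exists g, mon_ideal A ('X_[m] * g) /\ ~ P g.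
      move=> m fm; apply: NNPP => nog; apply: noM; exists m; split=> // g Ag.
      by apply: NNPP => nPg; apply: nog; exists g.
    elim: (msupp f) => [_|m s IH H]; first by exists 1.
    have [g1 [Ag1 nPg1]] := H m (mem_head _ _).
    have [|g2 [nPg2 Ag2]] := IH; first by move=> v vs; apply: H; rewrite inE vs orbT.
    exists (g1 * g2); split=> [/pP[]//|v]; case: idA => _ _ mulA.
    rewrite inE => /orP[/eqP->|/Ag2 Av]; first by rewrite mulrA mulrC; apply: mulA.
    by rewrite mulrCA; apply: mulA.
  apply: nPg; rewrite Pf [f]mpolyE mulr_suml; apply: ideal_sum => // m /gA Am.
  by rewrite -mul_mpolyC -mulrA; case: idA => _ _; apply.
exists m; split=> [i /SP|v v0 Amv].
  by rewrite Pf mulrC => /mon_idealXM /(_ _ fm); rewrite addmC.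
have /PS : P 'X_[v] by apply: Pm; rewrite -mpolyXD; apply/mon_idealX.
exact/meetsN.
Qed.

Lemma Ass_mon_iff A B P : upset A -> upset B ->
  (forall S, (exists m, witness A S m) <-> (exists m, witness B S m)) ->
  Ass (mon_ideal A) P <-> Ass (mon_ideal B) P.
Proof.
move=> upA upB AB; rewrite !Ass_monP //.
by split=> -[S [-> /AB W]]; exists S.
Qed.

Lemma meets_inj S S' : mon_ideal (meets S) = mon_ideal (meets S') -> S = S'.
Proof.
move=> SS'; apply/setP => i.
have E (T : {set 'I_4}) : i \in T <-> mon_ideal (meets T) 'X_i.
  rewrite mon_idealX; split=> [Ti|[j Tj]]; first by exists i; rewrite // mnm1E eqxx.
  by rewrite mnm1E; case: eqP => [->|].
by apply/idP/idP => /E; [rewrite SS' | rewrite -SS'] => /E.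
Qed.

(** * Depth *)

Lemma max_gradedE : @max_graded K = mon_ideal (meets setT).
Proof.
apply: pred_ext => f; split=> [|mf].
  apply=> [|g [i ->]]; first exact/mon_idealP/meets_upset.
  by apply/mon_idealX; exists i; rewrite // mnm1E eqxx.
apply: ideal_monE => [|m /mf [i _ mi]]; first exact: gen_idealP.
have ->: m = ((m - U_(i)) + U_(i))%MM.
  by apply/mnmP => j; rewrite mnmDE mnmBE mnm1E; case: eqP => [<-|_]; lia.
rewrite mpolyXD => J idJ XJ; case: (idJ) => _ _; apply; apply: XJ; by exists i.
Qed.

Lemma ext_ideal_ideal L s : is_ideal (ext_ideal L s).
Proof. exact: gen_idealP. Qed.

Lemma ext_ideal_base L s f : L f -> ext_ideal L s f.
Proof. by move=> Lf J _; apply; left. Qed.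

Lemma ext_ideal0 L : is_ideal L -> ext_ideal L [::] = L.
Proof.
move=> idL; apply: pred_ext => f; split; last exact: ext_ideal_base.
by apply=> // g [].
Qed.

Lemma ext_ideal1 L f h : is_ideal L ->
  ext_ideal L [:: f] h <-> exists q, L (h - q * f).
Proof.
move=> idL; case: (idL) => L0 addL mulL; split=> [Eh|[q Lq]]; last first.
  move=> J [_ addJ mulJ] LJ; rewrite -[h](subrK (q * f)); apply: addJ.
    by apply: LJ; left.
  by apply/mulJ/LJ; right; rewrite inE.
apply: (Eh (fun h => exists q, L (h - q * f))) => [|g [Lg|]]; last first.
- by rewrite inE => /eqP->; exists 1; rewrite mul1r subrr.
- by exists 0; rewrite mul0r subr0.
split=> [|a b [q Lq] [q' Lq']|r a [q Lq]]; first by exists 0; rewrite mul0r subrr.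
  exists (q + q'); have ->: a + b - (q + q') * f = (a - q * f) + (b - q' * f) by ring.
  exact: addL.
by exists (r * q); rewrite -mulrA -mulrBr; apply: mulL.
Qed.

Lemma ext_ideal_cons L f s :
  ext_ideal L (f :: s) = ext_ideal (ext_ideal L [:: f]) s.
Proof.
apply: pred_ext => h; split=> Eh J idJ TJ; apply: Eh => // g.
  case=> [Lg|]; first by apply: TJ; left; apply: ext_ideal_base.
  rewrite inE => /orP[/eqP->|sg]; last by apply: TJ; right.
  by apply: TJ; left => J' _; apply; right; rewrite inE.
case=> [Eg|sg]; last by apply: TJ; right; rewrite inE sg orbT.
apply: Eg => // g' [Lg'|]; first by apply: TJ; left.
by rewrite inE => /eqP->; apply: TJ; right; rewrite mem_head.
Qed.

Definition regular_on L f := forall g, L (f * g) -> L g.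

Lemma regular_seq_cons L f s : is_ideal L ->
  regular_seq L (f :: s) <->
  [/\ max_graded f, regular_on L f & regular_seq (ext_ideal L [:: f]) s].
Proof.
move=> idL; split=> [[ms rs ns]|[mf rf [ms rs ns]]].
  split; first by apply: ms; rewrite mem_head.
    by move=> g; have := rs 0%N isT g; rewrite /= ext_ideal0.
  split=> [h sh|i si g|]; first by apply: ms; rewrite inE sh orbT.
    by have := rs i.+1 si g; rewrite /= ext_ideal_cons.
  by rewrite -ext_ideal_cons.
split=> [h|[|i] si g|]; last by rewrite ext_ideal_cons.
- by rewrite inE => /orP[/eqP->|/ms].
- by rewrite /= ext_ideal0 //; apply: rf.
- by rewrite /= ext_ideal_cons; apply: rs.
Qed.

Lemma regular_seq_nil L : is_ideal L -> ~ L 1 -> regular_seq L [::].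
Proof. by move=> idL L1; split=> //; rewrite ext_ideal0. Qed.

Lemma has_depth_unique L d d' : has_depth L d -> has_depth L d' -> d = d'.
Proof.
move=> [[s [rs <-]] maxs] [[s' [rs' <-]] maxs'].
by apply/eqP; rewrite eqn_leq maxs // maxs'.
Qed.

Lemma has_depthE L d d' : has_depth L d -> has_depth L d' <-> d' = d.
Proof.
by move=> Ld; split=> [Ld'|->//]; apply: has_depth_unique Ld' Ld.
Qed.

(** The maximal ideal annihilates the class of some [w] outside [L], so none of its elements is
    regular modulo [L]. *)
Lemma has_depth0 L : is_ideal L -> Ass L (@max_graded K) -> has_depth L 0.
Proof.
move=> idL [[_ m1 _] [w mw]]; have Lw : ~ L w by rewrite -[w]mulr1 -mw.
split=> [|[|f s] //].
  exists [::]; split=> //; apply: regular_seq_nil => // L1.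
  by apply: Lw; rewrite -[w]mulr1; case: idL => _ _; apply.
by case/regular_seq_cons=> // /mw; rewrite mulrC => Lwf /(_ _ Lwf).
Qed.

(* R/(L : w) has a disconnected punctured spectrum, the two parts being cut out
   by the variables in S and by the others.  If f, g were regular, some h would
   agree with w on one part and vanish on the other, so that w could occur
   neither in h nor in w - h. *)
Lemma disconnected_depth_lt2 A (S : {set 'I_4}) i j w : upset A ->
  i \in S -> j \notin S ->
  (forall k l, k \in S -> l \notin S -> A (w + U_(k) + U_(l))%MM) ->
  ~ A (w + U_(i))%MM -> ~ A (w + U_(j))%MM ->
  forall s, regular_seq (mon_ideal A) s -> (size s < 2)%N.
Proof.
move=> upA Si Sj Aw nAi nAj [|f [|g s]] //.
have idA := mon_idealP upA; have [_ addA mulA] := idA.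
case/regular_seq_cons=> // mf rf /regular_seq_cons[|mg rg _].
  exact: ext_ideal_ideal.
exfalso.
have split_max p : max_graded p -> exists p1 p2,
    [/\ p = p1 + p2, mon_ideal (meets S) p1 & mon_ideal (meets (~: S)) p2].
  rewrite max_gradedE => mp; have [p1 [p2 [Dp Sp1 Sp2]]] := split_supp (meets S) p.
  exists p1, p2; split=> // m p2m; have /meetsN nSm := Sp2 _ p2m.
  have : m \in msupp p.
    move: p2m; rewrite !mcoeff_msupp Dp mcoeffD => p2m.
    rewrite (_ : p1@_m = 0) ?add0r //; apply/eqP; rewrite mcoeff_eq0.
    by apply/negP => /Sp1 [k /nSm->].
  case/mp => k _ mk; exists k => //; rewrite inE; apply/negP => /nSm mk0.
  by rewrite mk0 in mk.
have cross p q : mon_ideal (meets S) p -> mon_ideal (meets (~: S)) q ->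
    mon_ideal A ('X_[w] * (p * q)).
  move=> Sp Sq; apply/mon_idealXM => m /msuppM_le /allpairsP[[m1 m2] /=].
  case=> /Sp [k Sk m1k] /Sq [l]; rewrite inE => Sl m2l ->.
  have ->: (w + (m1 + m2) = (w + U_(k) + U_(l)) + ((m1 - U_(k)) + (m2 - U_(l))))%MM.
    apply/mnmP => t; rewrite !mnmDE !mnmBE !mnm1E.
    by case: (k =P t) m1k => [->|_] m1k; case: (l =P t) m2l => [->|_] m2l; lia.
  by apply/upA/Aw.
have Xi : mon_ideal (meets S) 'X_i by apply/mon_idealX; exists i; rewrite // mnm1E eqxx.
have Xj : mon_ideal (meets (~: S)) 'X_j.
  by apply/mon_idealX; exists j; rewrite ?inE // mnm1E eqxx.
have [a1 [a2 [Df Sa1 Sa2]]] := split_max f mf.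
have [b1 [b2 [Dg Sb1 Sb2]]] := split_max g mg.
(* Modulo the ideal, [g * ('X_[w] * a2)] equals ['X_[w] * b2 * f], since mixed products vanish by
   [cross]. Regularity of [g] modulo [f] gives [h] with [h * f] congruent to ['X_[w] * a2]. *)
have [|h Ah] := (ext_ideal1 f ('X_[w] * a2) idA).1.
  apply: rg; apply/ext_ideal1 => //; exists ('X_[w] * b2).
  have ->: g * ('X_[w] * a2) - 'X_[w] * b2 * f = 'X_[w] * (b1 * a2) - 'X_[w] * (a1 * b2).
    by rewrite Df Dg; ring.
  by apply: (ideal_sub idA); apply: cross.
have hi : mon_ideal A ('X_i * h).
  apply: rf; have ->: f * ('X_i * h) = 'X_[w] * ('X_i * a2) - 'X_i * ('X_[w] * a2 - h * f).
    by ring.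
  by apply: (ideal_sub idA); [apply: cross | apply: mulA].
have hj : mon_ideal A ('X_j * ('X_[w] - h)).
  apply: rf; have ->: f * ('X_j * ('X_[w] - h)) =
     'X_[w] * (a1 * 'X_j) + 'X_j * ('X_[w] * a2 - h * f) by rewrite Df; ring.
  by apply: addA; [apply: cross | apply: mulA].
have hw : h@_w = 0.
  apply/eqP; rewrite mcoeff_eq0; apply/negP => hw; apply: nAi.
  by move/mon_idealXM/(_ _ hw): hi; rewrite addmC.
suff : ('X_[w] - h)@_w = 0.
  by rewrite mcoeffB hw mcoeffX eqxx subr0 => /eqP; rewrite oner_eq0.
apply/eqP; rewrite mcoeff_eq0; apply/negP => wh; apply: nAj.
by move/mon_idealXM/(_ _ wh): hj; rewrite addmC.
Qed.

End MonomialIdeals.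

(** * Depth in four variables: a bound on regular sequences, and the powers of (xy, zu) *)

Local Notation x_ := (@Ordinal 4 0 isT).
Local Notation y_ := (@Ordinal 4 1 isT).
Local Notation z_ := (@Ordinal 4 2 isT).
Local Notation u_ := (@Ordinal 4 3 isT).

Section MonomialDepth.
Import Order.TTheory GRing.Theory.
Local Open Scope ring_scope.
Variable K : fieldType.
Local Notation R := {mpoly K[4]}.
Local Notation Mon := 'X_{1..4}.
Implicit Types (L : R -> Prop) (A B : Mon -> Prop) (f g h : R) (m v : Mon).

Lemma ord4P (P : 'I_4 -> Prop) : P x_ -> P y_ -> P z_ -> P u_ -> forall i, P i.
Proof.
move=> Px Py Pz Pu [[|[|[|[|i]]]] lti] //.
- by rewrite (_ : Ordinal _ = x_) //; apply: val_inj.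
- by rewrite (_ : Ordinal _ = y_) //; apply: val_inj.
- by rewrite (_ : Ordinal _ = z_) //; apply: val_inj.
- by rewrite (_ : Ordinal _ = u_) //; apply: val_inj.
Qed.

Definition mon4 (a b c d : nat) : Mon := [multinom nth 0%N [:: a; b; c; d] i | i < 4].

Lemma mon4E a b c d :
  (mon4 a b c d x_ = a) * (mon4 a b c d y_ = b) *
  (mon4 a b c d z_ = c) * (mon4 a b c d u_ = d).
Proof. by rewrite !mnmE. Qed.

Lemma mon4_eta m : m = mon4 (m x_) (m y_) (m z_) (m u_).
Proof. by apply/mnmP; apply: ord4P; rewrite mon4E. Qed.

(** Modulo [f] only [h 0] survives, so it vanishes; what remains is [f] times a shorter sum, and [f]
    cancels because it is regular. *)
Lemma regular_sum_eq0 L f (h : nat -> R) r : is_ideal L -> regular_on L f ->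
  (forall i, ext_ideal L [:: f] (h i) -> h i = 0) ->
  L (\sum_(i < r) f ^+ i * h i) -> forall i, (i < r)%N -> h i = 0.
Proof.
move=> idL rf; elim: r h => [//|r IH] h h0.
rewrite big_ord_recl expr0 mul1r.
have ->: \sum_(i < r) f ^+ lift ord0 i * h (lift ord0 i) =
         f * \sum_(i < r) f ^+ i * h i.+1.
  by rewrite mulr_sumr; apply: eq_bigr => i _; rewrite lift0 exprS mulrA.
move=> Lh; have h00 : h 0%N = 0.
  apply/h0/ext_ideal1 => //.
  by exists (- \sum_(i < r) f ^+ i * h i.+1); rewrite mulNr opprK [X in h _ + X]mulrC.
move: Lh; rewrite h00 add0r => /rf Lh [|i] //.
by rewrite ltnS => ir; apply: (IH (h \o succn)) => // j /h0.
Qed.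

(** The coefficients at the exponents [B u] form a matrix with more rows than columns, so its left
    kernel is nonzero. *)
Lemma linear_dependence (T U : finType) (v : T -> R) (B : U -> Mon) :
  (#|U| < #|T|)%N ->
  exists c : T -> K, (exists t, c t != 0) /\
    forall u, (\sum_t c t *: v t)@_(B u) = 0.
Proof.
move=> UT; pose M := \matrix_(i < #|T|, j < #|U|) (v (enum_val i))@_(B (enum_val j)).
have kM : kermx M != 0.
  rewrite -mxrank_eq0 mxrank_ker subn_eq0 -ltnNge.
  exact: leq_ltn_trans (rank_leq_col M) UT.
have [w /sub_kermxP wM w0] := rowV0Pn kM.
exists (fun t => w 0 (enum_rank t)); split.
  apply: NNPP => nw; case/eqP: w0; apply/rowP => i; rewrite mxE.
  by apply/eqP/negPn/negP => wi; apply: nw; exists (enum_val i); rewrite enum_valK.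
move=> u; have /rowP/(_ (enum_rank u)) := wM; rewrite !mxE => wMu; apply: etrans wMu.
rewrite raddf_sum /= (reindex (@enum_val T (mem T))) /=; last first.
  by apply: onW_bij; apply: enum_val_bij.
by apply: eq_bigr => i _; rewrite mcoeffZ enum_valK mxE enum_rankK.
Qed.

Lemma msizeM_bound f g a b :
  (msize f <= a.+1)%N -> (msize g <= b.+1)%N -> (msize (f * g)%R <= (a + b).+1)%N.
Proof.
have [->|f0] := eqVneq f 0; first by rewrite mul0r msize0.
have [->|g0] := eqVneq g 0; first by rewrite mulr0 msize0.
by rewrite msizeM //; move: (msize f) (msize g) => i j; lia.
Qed.

Lemma msizeX_bound f a k : (msize f <= a.+1)%N -> (msize (f ^+ k)%R <= (k * a).+1)%N.
Proof.
move=> fa; elim: k => [|k IH]; first by rewrite expr0 msize1.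
by rewrite exprS mulSn; apply: msizeM_bound.
Qed.

Lemma mnm_le_mdeg m i : (m i <= mdeg m)%N.
Proof. by rewrite mdegE (bigD1 i) //= leq_addr. Qed.

(* Three elements regular on R/L give linearly independent monomials modulo L,
   about r^3 of them in degree O(r), whereas R/L has only O(r^2) monomials there. *)
Lemma size_regular_seq_le2 A q (s : seq R) : upset A ->
  (forall m, (q <= m x_)%N -> (q <= m y_)%N -> A m) ->
  (forall m, (q <= m z_)%N -> (q <= m u_)%N -> A m) ->
  regular_seq (mon_ideal A) s -> (size s <= 2)%N.
Proof.
move=> upA Axy Azu; case: s => [|f1 [|f2 [|f3 s]]] // reg; exfalso.
have idA : is_ideal (mon_ideal A : R -> Prop) by apply: mon_idealP.
move: reg; case/regular_seq_cons => // _ reg1; set L1 := ext_ideal _ [:: f1].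
have idL1 : is_ideal L1 by apply: ext_ideal_ideal.
case/regular_seq_cons => // _ reg2; set L2 := ext_ideal _ [:: f2].
have idL2 : is_ideal L2 by apply: ext_ideal_ideal.
case/regular_seq_cons => // _ reg3; set L3 := ext_ideal _ [:: f3] => reg4.
have idL3 : is_ideal L3 by apply: ext_ideal_ideal.
have L3C (c : K) : L3 c%:MP -> c = 0.
  move=> Lc; apply/eqP/negPn/negP => c0; case: reg4 => _ _; apply.
  apply: ext_ideal_base.
  have ->: 1 = (c^-1)%:MP * c%:MP :> R by rewrite -mpolyCM mulVf.
  by case: idL3 => _ _; apply.
(* [E] exceeds the degree of every product in [v]. As E <= r (3D + 1), the 4 q^2 E^2 indices in [U]
   number at most r^2 (r - 1), fewer than the r^3 products. *)
pose D := maxn (msize f1) (maxn (msize f2) (msize f3)).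
pose r := (4 * q ^ 2 * (3 * D + 1) ^ 2).+1; pose E := (3 * (r * D)).+1.
pose T := ('I_r * ('I_r * 'I_r))%type.
pose U := ((bool * ('I_q * 'I_E)) * (bool * ('I_q * 'I_E)))%type.
pose v (t : T) : R := f1 ^+ t.1 * (f2 ^+ t.2.1 * f3 ^+ t.2.2).
(* A monomial outside [A] has an exponent below q among those of x, y and another among those of z,
   u; the Boolean tells which of the two it is. *)
pose sel (e : bool * ('I_q * 'I_E)) : nat * nat :=
  if e.1 then (val e.2.1, val e.2.2) else (val e.2.2, val e.2.1).
pose B (u : U) : Mon := mon4 (sel u.1).1 (sel u.1).2 (sel u.2).1 (sel u.2).2.
have selP a b : (a < E)%N -> (b < E)%N -> ~ ((q <= a) && (q <= b))%N ->
    exists e, sel e = (a, b).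
  move=> aE bE; case: (ltnP a q) => aq.
    by exists (true, (Ordinal aq, Ordinal bE)).
  case: (ltnP b q) => // bq _.
  by exists (false, (Ordinal bq, Ordinal aE)).
have [|c [[t ct] cB]] := @linear_dependence T U v B.
  rewrite !card_prod !card_ord card_bool.
  have ->: (2 * (q * E) * (2 * (q * E)) = 4 * q ^ 2 * E ^ 2)%N by ring.
  have Er : (E ^ 2 <= r ^ 2 * (3 * D + 1) ^ 2)%N.
    by rewrite -expnMn leq_exp2r // /E; nia.
  apply: leq_ltn_trans (leq_mul (leqnn _) Er) _.
  have ->: (4 * q ^ 2 * (r ^ 2 * (3 * D + 1) ^ 2) = r ^ 2 * r.-1)%N by rewrite /r /=; ring.
  by have: (0 < r)%N by []; move: (r) => ?; nia.
have LF : mon_ideal A (\sum_t c t *: v t).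
  move=> m mF; apply: NNPP => nAm.
  have mE i : (m i < E)%N.
    apply: leq_ltn_trans (mnm_le_mdeg m i) _.
    apply: leq_trans (msize_mdeg_lt mF) _.
    apply: leq_trans (msize_sum _ _ _) _; apply/bigmax_leqP => [[i1 [i2 i3]]] _.
    apply: leq_trans (msizeZ_le _ _) _.
    have fD f k : (msize f <= D)%N -> (k <= r)%N -> (msize (f ^+ k)%R <= (r * D).+1)%N.
      move=> fD kr; have := @msizeX_bound f D k (leqW fD); move/leq_trans; apply.
      by rewrite ltnS leq_mul2r kr orbT.
    have -> : E = (r * D + (r * D + r * D)).+1 by rewrite /E; ring.
    by rewrite /v /=; do 2?[apply: msizeM_bound]; apply: fD; rewrite ?(ltnW (ltn_ord _)) // /D; lia.
  have [|e1 se1] := selP _ _ (mE x_) (mE y_).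
    by case/andP => mx my; apply/nAm/Axy.
  have [|e2 se2] := selP _ _ (mE z_) (mE u_).
    by case/andP => mz mu; apply/nAm/Azu.
  move: mF; rewrite mcoeff_msupp [m]mon4_eta.
  by have := cB (e1, e2); rewrite /B /= se1 se2 /= => ->; rewrite eqxx.
(* The dependence is read as a polynomial in [f1] whose coefficients are polynomials in [f2], and
   theirs in [f3]. Regularity kills the coefficients layer by layer, down to the scalars. *)
pose c' i j l : K := c (inord i, (inord j, inord l)).
pose h2 i j := \sum_(l < r) f3 ^+ l * (c' i j l)%:MP.
pose h1 i := \sum_(j < r) f2 ^+ j * h2 i j.
have h20 i j : L2 (h2 i j) -> forall l, (l < r)%N -> c' i j l = 0.
  move=> Lh l lr; apply/eqP; rewrite -(mpolyC_eq 4); apply/eqP.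
  rewrite mpolyC0; apply: (regular_sum_eq0 idL2 reg3 (h := fun l => (c' i j l)%:MP)) lr => //.
  by move=> k /L3C ->.
have h2z i j : L2 (h2 i j) -> h2 i j = 0.
  by move=> Lh; apply: big1 => l _; rewrite (h20 _ _ Lh) // mpolyC0 mulr0.
have h10 i : L1 (h1 i) -> forall j, (j < r)%N -> h2 i j = 0.
  by move=> Lh j jr; apply: (regular_sum_eq0 idL1 reg2 (h2z i) Lh jr).
have h1z i : L1 (h1 i) -> h1 i = 0.
  by move=> Lh; apply: big1 => j _; rewrite (h10 _ Lh) // mulr0.
have FE : \sum_t c t *: v t = \sum_(i < r) f1 ^+ i * h1 i.
  transitivity (\sum_(i < r) \sum_p c (i, p) *: v (i, p)).
    by rewrite pair_bigA; apply: eq_bigr => -[].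
  apply: eq_bigr => i _; rewrite /h1 mulr_sumr.
  transitivity (\sum_(j < r) \sum_(l < r) c (i, (j, l)) *: v (i, (j, l))).
    by rewrite pair_bigA; apply: eq_bigr => -[].
  apply: eq_bigr => j _; rewrite /h2 !mulr_sumr; apply: eq_bigr => l _.
  by rewrite /c' !inord_val -mul_mpolyC /v /=; ring.
have h1i i : (i < r)%N -> h1 i = 0.
  by apply: (regular_sum_eq0 idA reg1 h1z); rewrite -FE.
case/eqP: ct; case: t => i [j l].
have [L10 _ _] := idL1; have [L20 _ _] := idL2.
have h1i0 := h1i _ (ltn_ord i).
have := h10 i; rewrite h1i0 => /(_ L10 _ (ltn_ord j)) h2ij.
have := h20 i j; rewrite h2ij => /(_ L20 _ (ltn_ord l)).
by rewrite /c' !inord_val.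
Qed.


(* X_i - X_j divides X_i^N - X_j^N, and for N large the products of a fixed
   polynomial with X_i^N and with X_j^N have disjoint supports. *)
Lemma regular_on_subX A i j : upset A -> i != j ->
  (forall N m, A (m + U_(i) *+ N)%MM -> A (m + U_(j) *+ N)%MM -> A m) ->
  regular_on (mon_ideal A) ('X_i - 'X_j : R).
Proof.
move=> upA ij AN h Ah m hm; have idA : is_ideal (mon_ideal A : R -> Prop) by apply: mon_idealP.
pose N := msize h.
have AhN : mon_ideal A (('X_i ^+ N - 'X_j ^+ N) * h : R).
  by rewrite subrXX mulrAC mulrC; case: idA => _ _; apply.
have hN v k : v \in msupp h -> (v k < N)%N.
  by move=> hv; apply: leq_ltn_trans (mnm_le_mdeg v k) (msize_mdeg_lt hv).
have supp_shift k l : k != l ->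
    (m + U_(k) *+ N)%MM \in msupp ('X_k ^+ N * h) /\
    (m + U_(k) *+ N)%MM \notin msupp ('X_l ^+ N * h).
  move=> kl; rewrite !mpolyXn ![_ * h]mulrC; split.
    by rewrite (perm_mem (msuppMX h _)) addmC map_f.
  rewrite (perm_mem (msuppMX h _)); apply/mapP => -[v hv] /mnmP/(_ l).
  rewrite !mnmDE !mulmnE !mnm1E eqxx (negPf kl).
  by have := hN m l hm; lia.
apply: (AN N); apply: AhN; rewrite mulrBl mcoeff_msupp mcoeffB.
  have [inN /memN_msupp_eq0 ->] := supp_shift i j ij.
  by rewrite subr0 -mcoeff_msupp.
rewrite eq_sym in ij; have [inN /memN_msupp_eq0 ->] := supp_shift j i ij.
by rewrite sub0r oppr_eq0 -mcoeff_msupp.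
Qed.

(** The exponents of the monomials in (xy, zu)^q: the two minima count the factors xy and zu that
    can be split off. *)
Definition pow_xy_zu q : Mon -> Prop :=
  fun m => (q <= minn (m x_) (m y_) + minn (m z_) (m u_))%N.

Lemma pow_xy_zu_upset q : upset (pow_xy_zu q).
Proof. by move=> m v; rewrite /pow_xy_zu !mnmDE; lia. Qed.

(** The sequence x - y, z - u is regular, and [size_regular_seq_le2] excludes longer ones. Working
    modulo x - y amounts to substituting y for x, which keeps the ideal monomial. *)
Lemma has_depth_pow_xy_zu q : (0 < q)%N ->
  has_depth (mon_ideal (pow_xy_zu q) : R -> Prop) 2.
Proof.
move=> q0; set A := pow_xy_zu q; have upA : upset A := @pow_xy_zu_upset q.
have idA : is_ideal (mon_ideal A : R -> Prop) by apply: mon_idealP.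
split; last first.
  by move=> s; apply: (size_regular_seq_le2 (q := q) upA) => m; rewrite /A /pow_xy_zu; lia.
pose f : R := 'X_x_ - 'X_y_; pose g : R := 'X_z_ - 'X_u_.
have max_id : is_ideal (@max_graded K) by apply: gen_idealP.
have maxX i : max_graded ('X_i : R) by move=> J _; apply; exists i.
have mf : max_graded f by apply: (ideal_sub max_id).
have mg : max_graded g by apply: (ideal_sub max_id).
(* The exponents that agree with one in [A] once x and y are identified. *)
pose A' m := exists m', [/\ A m', (m' x_ + m' y_ = m x_ + m y_)%N, m' z_ = m z_ & m' u_ = m u_].
have upA' : upset A'.
  move=> m v [m' [Am' mxy mz mu]]; exists (m' + v)%MM; rewrite !mnmDE mz mu.
  by split=> //; [apply: upA | lia].
have idA' : is_ideal (mon_ideal A' : R -> Prop) by apply: mon_idealP.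
pose X' := [tuple ('X_(if i == x_ then y_ else i) : R) | i < 4].
pose phi (h : R) := h \mPo X'.
have phiXi i : phi 'X_i = 'X_(if i == x_ then y_ else i).
  by rewrite /phi comp_mpolyXU -tnth_nth tnth_mktuple.
have phiM a b : phi (a * b) = phi a * phi b by rewrite /phi rmorphM.
have phiX m : phi 'X_[m] = 'X_[mon4 0 (m x_ + m y_) (m z_) (m u_)].
  rewrite {1}[m]mon4_eta /phi comp_mpolyX [RHS]mpolyXE_id.
  rewrite !big_ord_recl !big_ord0 !tnth_mktuple !mnmE /=.
  by rewrite expr0 mul1r exprD !mulrA.
have phif : phi f = 0 by rewrite /f /phi raddfB /= -!/(phi _) !phiXi subrr.
have phig : phi g = g by rewrite /g /phi raddfB /= -!/(phi _) !phiXi.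
have phi_mod h : exists p, h - phi h = p * f.
  have modD a b : (exists p, a - phi a = p * f) -> (exists p, b - phi b = p * f) ->
      exists p, (a + b) - phi (a + b) = p * f.
    move=> [p Dp] [p' Dp']; exists (p + p').
    by rewrite /phi raddfD /= -!/(phi _) mulrDl -Dp -Dp'; ring.
  have modM a b : (exists p, a - phi a = p * f) -> (exists p, b - phi b = p * f) ->
      exists p, a * b - phi (a * b) = p * f.
    move=> [p Dp] [p' Dp']; exists (p * b + phi a * p').
    have -> : (p * b + phi a * p') * f = p * f * b + phi a * (p' * f) by ring.
    by rewrite -Dp -Dp' phiM; ring.
  have modC c : exists p, c%:MP - phi c%:MP = p * f.
    by exists 0; rewrite /phi comp_mpolyC subrr mul0r.
  have modX i : exists p, 'X_i - phi 'X_i = p * f.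
    rewrite phiXi; case: eqP => [->|_]; first by exists 1; rewrite mul1r.
    by exists 0; rewrite subrr mul0r.
  elim/mpolyind: h => [|c m h _ _ IH]; first by rewrite -mpolyC0.
  apply: modD => //; rewrite -mul_mpolyC mpolyXE_id; apply: (modM) => //.
  apply: (big_ind (fun a => exists p, a - phi a = p * f)) => [||i _].
  - by rewrite -mpolyC1.
  - exact: modM.
  by elim: (m i) => [|k IHk]; rewrite ?expr0 -?mpolyC1 // exprS; apply: modM.
have phiA h : mon_ideal A h -> mon_ideal A' (phi h).
  move=> Ah; rewrite [h]mpolyE /phi raddf_sum /=.
  apply: (ideal_sum idA') => m /Ah Am; rewrite comp_mpolyZ -/(phi _) phiX -mul_mpolyC.
  case: idA' => _ _; apply; apply/mon_idealX; exists m.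
  by rewrite !mon4E.
have A'E h : mon_ideal A' h -> ext_ideal (mon_ideal A) [:: f] h.
  move=> A'h; apply: ideal_monE => [|m /A'h [m' [Am' mxy mz mu]]].
    exact: ext_ideal_ideal.
  have [p Dp] := phi_mod 'X_[m]; have [p' Dp'] := phi_mod 'X_[m'].
  apply/ext_ideal1 => //; exists (p - p'); rewrite mulrBl -Dp -Dp' !phiX mxy mz mu.
  by have -> : forall a b c : R, a - (a - b - (c - b)) = c; [move=> *; ring | apply/mon_idealX].
exists [:: f; g]; split=> //; apply/regular_seq_cons => //; split=> //.
  by apply: regular_on_subX => // N m; rewrite /A /pow_xy_zu !mnmDE !mulmnE !mnm1E /=; lia.
have idE := @ext_ideal_ideal K (mon_ideal A) [:: f].
apply/regular_seq_cons => //; split=> // [h|].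
  case/(ext_ideal1 _ _ idA).1 => p /phiA.
  rewrite /phi raddfB /= -!/(phi _) !phiM phif phig mulr0 subr0.
  have reg_g : regular_on (mon_ideal A') g.
    apply: regular_on_subX => // N m [m1 [Am1 xy1 z1 u1]] [m2 [Am2 xy2 z2 u2]].
    move: Am1 Am2 xy1 z1 u1 xy2 z2 u2; rewrite /A /pow_xy_zu !mnmDE !mulmnE !mnm1E /=.
    move=> Am1 Am2 xy1 z1 u1 xy2 z2 u2.
    (* Both witnesses have the same total degree in x and y, so the one with the larger minimum of
       these two exponents serves for [m], whichever of z and u has the smaller exponent. *)
    case: (leqP (minn (m1 x_) (m1 y_)) (minn (m2 x_) (m2 y_))) => le12.
      exists (mon4 (m2 x_) (m2 y_) (m z_) (m u_)); rewrite /A /pow_xy_zu !mon4E.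
      by split=> //; lia.
    exists (mon4 (m1 x_) (m1 y_) (m z_) (m u_)); rewrite /A /pow_xy_zu !mon4E.
    by split=> //; lia.
  move/reg_g/A'E => Eh; have [p' Dp'] := phi_mod h.
  rewrite -[h](subrK (phi h)) Dp'; case: (idE) => _ addE mulE; apply: addE => //.
  by apply: mulE => J _; apply; right; rewrite inE.
apply: regular_seq_nil => [|E1]; first exact: ext_ideal_ideal.
have [_ max1 _] := meets_prime K setT; apply: max1; rewrite -max_gradedE.
have sub_max L (p : R) : (forall h, L h -> max_graded h) -> max_graded p ->
    forall h, ext_ideal L [:: p] h -> max_graded h.
  by move=> Lm mp h; apply=> // a [/Lm //|]; rewrite inE => /eqP->.
apply: (sub_max _ g _ _ _ E1) => //; apply: sub_max => // h Ah.
rewrite max_gradedE => m /Ah Am; apply: NNPP => /meetsN m0.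
by move: Am; rewrite /A /pow_xy_zu !m0 ?inE //; lia.
Qed.

End MonomialDepth.

(** * The two families *)

Section Families.
Variable N : nat.
Local Notation Mon := 'X_{1..4}.
Implicit Types (m v : Mon) (S : {set 'I_4}).

(* The sums of k elements of {0, 1, N, N + 1}, at most d of them equal to 1;
   p is the number of summands N and N + 1, and q of summands 1. *)
Definition sums k d i := exists p q,
  [/\ q <= d, p + q <= k, p * N + q <= i & i <= p * N + p + q].

Lemma sums_add k k' d d' i i' :
  sums k d i -> sums k' d' i' -> sums (k + k') (d + d') (i + i').
Proof.
by move=> [p [q [? ? ? ?]]] [p' [q' [? ? ? ?]]]; exists (p + p'), (q + q'); split; nia.
Qed.

(** Without large summands a 0 or 1 is peeled off; otherwise N if i - N is within reach of the other
    summands, and N + 1 if not. [d1] counts a peeled 1. *)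
Lemma sums_split k d i : sums k.+1 d i -> exists i1 d1,
  [/\ i1 <= i, d1 <= d, i1 <= N.+1, sums 1 d1 i1 & sums k (d - d1) (i - i1)].
Proof.
move=> [[|p] [[|q] [qd pqk ilo ihi]]].
- by exists 0, 0; split; rewrite ?subn0; try lia; exists 0, 0; split; lia.
- exists 1, 1; split; try lia; first by exists 0, 1; split; lia.
  by exists 0, q; split; lia.
- case: (leqP i (p * N + p + N)) => ij.
    exists N, 0; split; try nia; first by exists 1, 0; split; lia.
    by exists p, 0; split; nia.
  exists N.+1, 0; split; try nia; first by exists 1, 0; split; lia.
  by exists p, 0; split; nia.
- case: (leqP i (p * N + p + q.+1 + N)) => ij.
    exists N, 0; split; try nia; first by exists 1, 0; split; lia.
    by exists p, q.+1; split; nia.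
  exists N.+1, 0; split; try nia; first by exists 1, 0; split; lia.
  by exists p, q.+1; split; nia.
Qed.

Lemma sums_le k d i : 0 < N -> sums k d i -> i <= k * N.+1.
Proof. by move=> N0 [p [q [? ? ? ?]]]; nia. Qed.

Lemma sums_mono k d d' i : d <= d' -> sums k d i -> sums k d' i.
Proof. by move=> dd [p [q [? ? ? ?]]]; exists p, q; split; lia. Qed.

(** Summands 0 and 1 alone give at most k, while a single N or N + 1 already exceeds k + 1. *)
Lemma sums_gap k d : k.+1 < N -> ~ sums k d k.+1.
Proof. by move=> kN [[|p] [q [? ? ? ?]]]; nia. Qed.

(** Divide i by N. If the quotient is at most k, the remainder, being less than N <= k + 1, is
    spread over the k summands by turning N into N + 1 and 0 into 1. Otherwise all k summands are
    large. *)
Lemma sums_full k i : N <= k.+1 -> 0 < N -> i <= k * N.+1 -> sums k k i.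
Proof.
move=> Nk N0 ik; case: (leqP (i %/ N) k) => ipk.
  have := divn_eq i N; have := ltn_pmod i N0; move: (i %/ N) (i %% N) ipk => p r pk rN ip.
  by exists p, (minn r (k - p)); split; lia.
by exists k, 0; move: ipk; rewrite leq_divRL //; split; nia.
Qed.


(* The exponents of the monomials in the powers I^k and J^k. *)
Definition idI k : Mon -> Prop := fun m =>
  k * N.+1 <= m x_ + m y_ /\
  (k * N.+1 < m x_ + m y_ + m z_ \/ sums k (m u_) (m x_)).

Definition idJ k : Mon -> Prop := fun m =>
  [/\ k * N.+1 <= m x_ + m u_, k * N.+1 <= m y_ + m z_,
      k * N.+1 <= m x_ + m z_ /\ (k * N.+1 < m x_ + m z_ \/ sums k k (m x_)) &
      k * N.+1 <= m y_ + m u_ /\ (k * N.+1 < m y_ + m u_ \/ sums k k (m y_))].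

Hypothesis N0 : 0 < N.

Lemma idI_upset k : upset (idI k).
Proof.
move=> m v [mxy mI]; rewrite /idI !mnmDE; split; first lia.
case: mI => [mxyz|mS]; first by left; lia.
case: (posnP (v x_)) => vx.
  by right; rewrite vx addn0; apply: sums_mono mS; lia.
by left; lia.
Qed.

Lemma idJ_upset k : upset (idJ k).
Proof.
move=> m v [mxu myz [mxz mJ] [myu mJ']]; rewrite /idJ !mnmDE; split; try lia.
  split; first lia; case: mJ => [|mS]; first by left; lia.
  case: (posnP (v x_)) => vx; last by left; lia.
  by right; rewrite vx addn0.
split; first lia; case: mJ' => [|mS]; first by left; lia.
case: (posnP (v y_)) => vx; last by left; lia.
by right; rewrite vx addn0.
Qed.

Lemma idI0 m : idI 0 m.
Proof.
split=> //; case: (posnP (m x_)) => mx; last by left; lia.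
by right; rewrite mx; exists 0, 0.
Qed.

Lemma idJ0 m : idJ 0 m.
Proof.
split=> //; split=> //; [case: (posnP (m x_)) | case: (posnP (m y_))] => mx; try (by left; lia).
  by right; rewrite mx; exists 0, 0.
by right; rewrite mx; exists 0, 0.
Qed.

Lemma sums1_ends d : sums 1 d 0 /\ sums 1 d N.+1.
Proof. by split; [exists 0, 0 | exists 1, 0]; split; lia. Qed.

Lemma mon4_split m (a b c d : nat) : a <= m x_ -> b <= m y_ -> c <= m z_ -> d <= m u_ ->
  m = (mon4 a b c d + mon4 (m x_ - a) (m y_ - b) (m z_ - c) (m u_ - d))%MM.
Proof. by move=> *; apply/mnmP; apply: ord4P; rewrite mnmDE !mon4E; lia. Qed.

(** If the degree in x, y, z is in excess, x^n or y^n is split off and the excess stays in the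
    cofactor. Otherwise a summand i1 of the exponent of x gives the factor x^i1 y^(n - i1) u^d1. *)
Lemma idIS k m : idI k.+1 m <-> addset (idI 1) (idI k) m.
Proof.
split=> [[mxy]|[m1 [m2 [[xy1 I1] [xy2 I2] ->]]]]; last first.
  rewrite /idI !mnmDE; split; first by nia.
  case: I1 => [|S1]; first by left; nia.
  case: I2 => [|S2]; first by left; nia.
  by right; rewrite -add1n; apply: sums_add.
case=> [mxyz|].
  (* Only for k > 0 is the degree in x and y at least 2n, so that one of the two exponents reaches
     n. *)
  case: (posnP k) => [k0|k0].
    exists m, 0%MM; rewrite addm0 k0; split=> //; last exact: idI0.
    by move: mxyz mxy; rewrite k0 => *; split=> //; left.
  have [S0 SN] := sums1_ends 0.
  case: (leqP N.+1 (m x_)) => mx.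
    exists (mon4 N.+1 0 0 0), (mon4 (m x_ - N.+1) (m y_ - 0) (m z_ - 0) (m u_ - 0)).
    split; [| | by apply: mon4_split]; rewrite /idI !mon4E.
      by split; [lia | right].
    by split; [nia | left; nia].
  exists (mon4 0 N.+1 0 0), (mon4 (m x_ - 0) (m y_ - N.+1) (m z_ - 0) (m u_ - 0)).
  split; [| | by apply: mon4_split => //; nia]; rewrite /idI !mon4E.
    by split; [lia | right].
  by split; [nia | left; nia].
move/sums_split => [i1 [d1 [i1x d1u i1N S1 S2]]]; have i2 := sums_le N0 S2.
exists (mon4 i1 (N.+1 - i1) 0 d1).
exists (mon4 (m x_ - i1) (m y_ - (N.+1 - i1)) (m z_ - 0) (m u_ - d1)).
split; [| | by apply: mon4_split => //; nia]; rewrite /idI !mon4E.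
  by split; [lia | right].
by split; [nia | right].
Qed.

(** Exchanging x with y and z with u fixes s and t. *)
Lemma idJ_swap k m : idJ k m -> idJ k (mon4 (m y_) (m x_) (m u_) (m z_)).
Proof. by case=> *; rewrite /idJ !mon4E; split=> //; lia. Qed.

Lemma idJS k m : idJ k.+1 m <-> addset (idJ 1) (idJ k) m.
Proof.
split=> [|[m1 [m2 [[xu1 yz1 [xz1 J1] [yu1 J1']] [xu2 yz2 [xz2 J2] [yu2 J2']] ->]]]]; last first.
  rewrite /idJ !mnmDE; split; try nia; split; try nia.
    case: J1 => [|S1]; first by left; nia.
    case: J2 => [|S2]; first by left; nia.
    by right; rewrite -add1n; apply: sums_add.
  case: J1' => [|S1]; first by left; nia.
  case: J2' => [|S2]; first by left; nia.
  by right; rewrite -add1n; apply: sums_add.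
have half m' : idJ k.+1 m' -> m' x_ + m' z_ = k.+1 * N.+1 -> addset (idJ 1) (idJ k) m'.
  move=> [xu yz [xz J] [yu J']] exz; case: J => [|]; first lia.
  move/sums_split => [i1 [d1 [i1x d1u i1N S1 S2]]]; have i2 := sums_le N0 S2.
  have {}S1 : sums 1 1 i1 by case: S1 => p [q [? ? ? ?]]; exists p, q; split; lia.
  have {}S2 : sums k k (m' x_ - i1) by case: S2 => p [q [? ? ? ?]]; exists p, q; split; lia.
  have T : k.+1 * N.+1 = k * N.+1 + N.+1 by rewrite mulSn addnC.
  have [xy zu zi] : [/\ m' x_ <= m' y_, m' z_ <= m' u_ & N.+1 - i1 <= m' z_] by split; lia.
  exists (mon4 i1 i1 (N.+1 - i1) (N.+1 - i1)).
  exists (mon4 (m' x_ - i1) (m' y_ - i1) (m' z_ - (N.+1 - i1)) (m' u_ - (N.+1 - i1))).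
  split; [| | by apply: mon4_split => //; nia]; rewrite /idJ !mon4E.
    by split; try lia; (split; [lia | right]).
  split; try lia; split; try lia; first by right.
  case: (ltngtP (m' y_ + m' u_) (k.+1 * N.+1)) => yuN; try lia.
  have -> : m' y_ = m' x_ by lia.
  by right.
move=> mJ; have [xu yz [xz J] [yu J']] := mJ.
case: (ltngtP (m x_ + m z_) (k.+1 * N.+1)) => exz; try lia; last exact: half.
case: (ltngtP (m y_ + m u_) (k.+1 * N.+1)) => eyu; try lia; last first.
  have [|m1 [m2 [J1 J2 E]]] := half _ (idJ_swap mJ); first by rewrite !mon4E.
  exists (mon4 (m1 y_) (m1 x_) (m1 u_) (m1 z_)), (mon4 (m2 y_) (m2 x_) (m2 u_) (m2 z_)).
  split; try exact: idJ_swap.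
  have Ei i : mon4 (m y_) (m x_) (m u_) (m z_) i = m1 i + m2 i by rewrite E mnmDE.
  have := Ei x_; have := Ei y_; have := Ei z_; have := Ei u_; rewrite !mon4E => *.
  by apply/mnmP; apply: ord4P; rewrite mnmDE !mon4E.
(* Now both degrees, in x, z and in y, u, are in excess. For k > 0 one of s^n, t^n divides the
   monomial, and the cofactor keeps the excess. *)
case: (posnP k) => [k0|k0].
  by exists m, 0%MM; rewrite addm0 k0; split=> //; [move: mJ; rewrite k0 | apply: idJ0].
have [S0 SN] := sums1_ends 1.
case: (leqP N.+1 (minn (m x_) (m y_))) => mxy.
  exists (mon4 N.+1 N.+1 0 0), (mon4 (m x_ - N.+1) (m y_ - N.+1) (m z_ - 0) (m u_ - 0)).
  split; [| | by apply: mon4_split => //; lia]; rewrite /idJ !mon4E.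
    by split; try lia; (split; [lia | right]).
  by split; try nia; (split; [nia | left; nia]).
exists (mon4 0 0 N.+1 N.+1), (mon4 (m x_ - 0) (m y_ - 0) (m z_ - N.+1) (m u_ - N.+1)).
split; [| | by apply: mon4_split => //; nia]; rewrite /idJ !mon4E.
  by split; try lia; (split; [lia | right]).
by split; try nia; (split; [nia | left; nia]).
Qed.

End Families.

(** * Associated primes of the powers of I and J *)

Section AssociatedPrimes.
Variable N : nat.
Local Notation Mon := 'X_{1..4}.
Implicit Types (m v : Mon) (S : {set 'I_4}).
Hypothesis N0 : 0 < N.

Lemma witness_off (A : Mon -> Prop) S m v :
  witness A S m -> A (m + v)%MM -> exists2 i, i \in S & 0 < v i.
Proof.
move=> [_ nA] Av; apply: NNPP => nS; apply: (nA v) => // i Si.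
by case: (posnP (v i)) => // vi; case: nS; exists i.
Qed.

(** The exponent 1 of x is a sum only if a summand 1 is permitted, which costs a factor u; a factor
    x, y or z gives excess degree instead. *)
Lemma witness_idI_full k : 0 < k -> 1 < N -> witness (idI N k) setT (mon4 1 (k * N.+1 - 1) 0 0).
Proof.
move=> k0 N1; have kN : k * N.+1 > 1 by nia.
split=> [|v v0 [_]]; last first.
  have v00 i : v i = 0 by apply: v0; rewrite inE.
  rewrite !mnmDE !mon4E !v00 !addn0 => -[|[[|p] [q [? ? ? ?]]]]; nia.
apply: ord4P => _; rewrite /idI !mnmDE !mnm1E !mon4E /=; split; try lia; try (by left; lia).
by right; exists 0, 1; split; lia.
Qed.

Lemma witness_idI_xy k : 0 < k ->
  witness (idI N k) [set x_; y_] (mon4 (k * N.+1 - 1) 0 1 0).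
Proof.
move=> k0; have kN : k * N.+1 > 0 by rewrite muln_gt0 k0.
split=> [i|v v0 [+ _]]; last first.
  by rewrite !mnmDE !mon4E !v0 ?inE //; lia.
by rewrite !inE => /orP[] /eqP->; rewrite /idI !mnmDE !mnm1E !mon4E /=; split; try lia; left; lia.
Qed.

(** The exponent k + 1 of x is a gap however many ones are permitted, so powers of u do not help. *)
Lemma witness_idI_xyz k : k.+1 < N -> 0 < k ->
  witness (idI N k) [set x_; y_; z_] (mon4 k.+1 (k * N.+1 - k.+1) 0 0).
Proof.
move=> kN k0; have kkN : k.+1 <= k * N.+1 by nia.
split=> [i|v v0 [_]]; last first.
  rewrite !mnmDE !mon4E (v0 x_) ?(v0 y_) ?(v0 z_) ?inE // !addn0 => -[|]; first lia.
  exact: sums_gap.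
rewrite !inE => /orP[/orP[]|] /eqP->; rewrite /idI !mnmDE !mnm1E !mon4E /=;
  by split; try lia; left; lia.
Qed.

(** If z or u lies in [S], the degree in x, y already reaches kn. Then a factor z gives excess
    degree, and u^k permits enough ones to make up for the missing sum, so both z and u lie in
    [S]. *)
Lemma witness_idI k S m : 0 < k -> N <= k.+1 -> witness (idI N k) S m ->
  S = [set x_; y_] \/ S = setT.
Proof.
move=> k0 Nk W; have [WS WN] := W; pose M := (k * N.+1).+1.
have off a b c d : idI N k (m + mon4 a b c d)%MM ->
    [|| (x_ \in S) && (0 < a), (y_ \in S) && (0 < b),
        (z_ \in S) && (0 < c) | (u_ \in S) && (0 < d)].
  case/(witness_off W); apply: ord4P => -> /=; rewrite !mon4E => ->; by rewrite ?orbT.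
have Sx : x_ \in S.
  have := off M 0 0 0; rewrite /M /= ?andbF ?andbT ?orbF /=; apply.
  by rewrite /idI !mnmDE !mon4E /M; split; [lia | left; lia].
have Sy : y_ \in S.
  have := off 0 M 0 0; rewrite /M /= ?andbF ?andbT ?orbF /=; apply.
  by rewrite /idI !mnmDE !mon4E /M; split; [lia | left; lia].
have Szu : (z_ \in S) || (u_ \in S) -> k * N.+1 <= m x_ + m y_.
  by case/orP => /WS [+ _]; rewrite !mnmDE !mnm1E /=; lia.
have Sz : u_ \in S -> z_ \in S.
  move=> Su; have := off 0 0 1 0; rewrite /= ?andbF ?andbT ?orbF /=; apply.
  rewrite /idI !mnmDE !mon4E; split; first by have := Szu; rewrite Su orbT => /(_ isT); lia.
  by left; have := Szu; rewrite Su orbT => /(_ isT); lia.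
have Su : z_ \in S -> u_ \in S.
  move=> Sz'; have mxy : k * N.+1 <= m x_ + m y_ by apply: Szu; rewrite Sz'.
  have := off 0 0 0 k; rewrite k0 /= ?andbF ?andbT ?orbF /=; apply.
  rewrite /idI !mnmDE !mon4E; split; first lia.
  case: (leqP (m x_) (k * N.+1)) => mx; last by left; lia.
  by right; rewrite addn0; apply: sums_mono (sums_full Nk N0 mx); lia.
case: (boolP (z_ \in S)) => Hz; [right | left]; apply/setP; apply: ord4P; rewrite !inE ?Sx ?Sy //.
- by rewrite Su.
- exact: negbTE.
- exact/negbTE/(contra Sz Hz).
Qed.

(** [idJ] imposes one condition on each of the pairs xu, yz, xz, yu. A witness violates one of them,
    which only the two variables of that pair can repair. *)
Lemma witness_idJ k S : 0 < k -> (exists m, witness (idJ N k) S m) <->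
  [\/ S = [set x_; z_], S = [set x_; u_], S = [set y_; z_] | S = [set y_; u_]].
Proof.
move=> k0; pose M := (k * N.+1).+1; have kN : 0 < k * N.+1 by rewrite muln_gt0 k0.
have top : sums N k k (k * N.+1).
  by exists k, 0; split; nia.
have below : sums N k k (k * N.+1 - 1).
  by exists k, 0; split; nia.
split=> [[m W]|]; last first.
  case=> ->.
  - exists (mon4 (k * N.+1 - 1) M 0 M); split=> [i|v v0]; last first.
      by case=> _ _ [+ _] _; rewrite !mnmDE !mon4E !v0 ?inE //; lia.
    rewrite !inE => /orP[] /eqP->; rewrite /idJ !mnmDE !mnm1E !mon4E /M /= ?addn0 ?add0n.
      by split; try lia; split; try lia; right; rewrite subnK.
    by split; try lia; split; try lia; right.
  - exists (mon4 (k * N.+1 - 1) M M 0); split=> [i|v v0]; last first.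
      by case=> + _ _ _; rewrite !mnmDE !mon4E !v0 ?inE //; lia.
    rewrite !inE => /orP[] /eqP->; rewrite /idJ !mnmDE !mnm1E !mon4E /M /= ?addn0 ?add0n;
      by split; try lia; split; lia.
  - exists (mon4 M (k * N.+1 - 1) 0 M); split=> [i|v v0]; last first.
      by case=> _ + _ _; rewrite !mnmDE !mon4E !v0 ?inE //; lia.
    rewrite !inE => /orP[] /eqP->; rewrite /idJ !mnmDE !mnm1E !mon4E /M /= ?addn0 ?add0n;
      by split; try lia; split; lia.
  - exists (mon4 M (k * N.+1 - 1) M 0); split=> [i|v v0]; last first.
      by case=> _ _ _ [+ _]; rewrite !mnmDE !mon4E !v0 ?inE //; lia.
    rewrite !inE => /orP[] /eqP->; rewrite /idJ !mnmDE !mnm1E !mon4E /M /= ?addn0 ?add0n.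
      by split; try lia; split; try lia; right; rewrite subnK.
    by split; try lia; split; try lia; right.
have [WS WN] := W.
have off a b c d : idJ N k (m + mon4 a b c d)%MM ->
    [|| (x_ \in S) && (0 < a), (y_ \in S) && (0 < b),
        (z_ \in S) && (0 < c) | (u_ \in S) && (0 < d)].
  case/(witness_off W); apply: ord4P => -> /=; rewrite !mon4E => ->; by rewrite ?orbT.
(* High powers of variables meeting all four pairs lead into the ideal, so one of these variables
   lies in [S]. *)
have big (a b c d : bool) : (a || d) && (b || c) && (a || c) && (b || d) ->
    [|| (x_ \in S) && a, (y_ \in S) && b, (z_ \in S) && c | (u_ \in S) && d].
  move=> H; have := off (a * M) (b * M) (c * M) (d * M).
  rewrite !muln_gt0 !lt0b !andbT; apply.
  rewrite /idJ !mnmDE !mon4E /M; move: H; case: a; case: b; case: c; case: d => // _;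
    by rewrite ?mul1n ?mul0n; split; try lia; split; lia.
have nm : ~ idJ N k m by move=> Im; apply: (WN 0%MM); rewrite ?addm0 // => i _; rewrite mnm0E.
have hit i : i \in S -> idJ N k (m + U_(i))%MM := WS i.
have [] : [\/ ~ k * N.+1 <= m x_ + m u_, ~ k * N.+1 <= m y_ + m z_,
    ~ (k * N.+1 <= m x_ + m z_ /\ (k * N.+1 < m x_ + m z_ \/ sums N k k (m x_))) |
    ~ (k * N.+1 <= m y_ + m u_ /\ (k * N.+1 < m y_ + m u_ \/ sums N k k (m y_)))].
  apply: NNPP => H; apply: nm; split; apply: NNPP => h; apply: H.
  - by constructor 1.
  - by constructor 2.
  - by constructor 3.
  - by constructor 4.
- move=> nxu; have [Sy Sz] : y_ \notin S /\ z_ \notin S.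
    by split; apply/negP => /hit[+ _ _ _]; rewrite !mnmDE !mnm1E /= !addn0.
  have := big true true true false isT; have := big false true true true isT.
  rewrite (negPf Sy) (negPf Sz) !andbF !andbT !orbF /= => Su Sx.
  by constructor 2; apply/setP; apply: ord4P; rewrite !inE ?Sx ?Su ?(negPf Sy) ?(negPf Sz).
- move=> nyz; have [Sx Su] : x_ \notin S /\ u_ \notin S.
    by split; apply/negP => /hit[_ + _ _]; rewrite !mnmDE !mnm1E /= !addn0.
  have := big true true false true isT; have := big true false true true isT.
  rewrite (negPf Sx) (negPf Su) !andbF !andbT !orbF /= => Sz Sy.
  by constructor 3; apply/setP; apply: ord4P; rewrite !inE ?Sz ?Sy ?(negPf Sx) ?(negPf Su).
- move=> nxz; have [Sy Su] : y_ \notin S /\ u_ \notin S.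
    by split; apply/negP => /hit[_ _ + _]; rewrite !mnmDE !mnm1E /= !addn0.
  have := big true true false true isT; have := big false true true true isT.
  rewrite (negPf Sy) (negPf Su) !andbF !andbT !orbF /= => Sz Sx.
  by constructor 1; apply/setP; apply: ord4P; rewrite !inE ?Sx ?Sz ?(negPf Sy) ?(negPf Su).
move=> nyu; have [Sx Sz] : x_ \notin S /\ z_ \notin S.
  by split; apply/negP => /hit[_ _ _ +]; rewrite !mnmDE !mnm1E /= !addn0.
have := big true true true false isT; have := big true false true true isT.
rewrite (negPf Sx) (negPf Sz) !andbF !andbT !orbF /= => Su Sy.
by constructor 4; apply/setP; apply: ord4P; rewrite !inE ?Su ?Sy ?(negPf Sx) ?(negPf Sz).
Qed.

End AssociatedPrimes.

(** * The stability indices of I and J *)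

Section Stability.
Variables (K : fieldType) (N : nat).
Local Notation R := {mpoly K[4]}.
Local Notation I := (mon_ideal (idI N 1) : R -> Prop).
Local Notation J := (mon_ideal (idJ N 1) : R -> Prop).

Hypothesis N2 : 2 < N.
Let N0 : 0 < N := ltn_trans (isT : 0 < 2) N2.

Lemma pow_idI k : pow_ideal I k = mon_ideal (idI N k).
Proof.
apply: (@pow_mon_ideal K (idI N)) => [||j m]; first exact: idI_upset.
  exact: idI0.
exact: idIS.
Qed.

Lemma pow_idJ k : pow_ideal J k = mon_ideal (idJ N k).
Proof.
apply: (@pow_mon_ideal K (idJ N)) => [||j m]; first exact: idJ_upset.
  exact: idJ0.
exact: idJS.
Qed.

Lemma has_depth_idI k : 0 < k -> has_depth (pow_ideal I k) 0.
Proof.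
move=> k0; rewrite pow_idI; apply: has_depth0; first exact/mon_idealP/idI_upset.
apply/Ass_monP; first exact: idI_upset.
exists setT; split; first exact: max_gradedE.
by eexists; apply: witness_idI_full => //; lia.
Qed.

Lemma dstab_idI : is_dstab I 1.
Proof.
split=> // [k k0 d|[|[|d]]] //.
by rewrite !(has_depthE _ (has_depth_idI _)).
Qed.

Lemma astab_idI : is_astab I N.-1.
Proof.
have witE k S : N.-1 <= k -> (exists m, witness (idI N k) S m) <->
    (S = [set x_; y_] \/ S = setT).
  move=> Nk; split=> [[m]|]; first by apply: witness_idI => //; lia.
  case=> ->; eexists; [apply: witness_idI_xy | apply: witness_idI_full] => //; lia.
split; first lia.
  move=> k Nk P; rewrite !pow_idI; apply: Ass_mon_iff; try exact: idI_upset.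
  by move=> S; rewrite !witE.
move=> a a0 aN stab; pose P : R -> Prop := mon_ideal (meets [set x_; y_; z_]).
(* [N.-2] is the last power with a gap; stability from [a] would carry (x, y, z) over to the power
   [N.-1]. *)
have : Ass (pow_ideal I N.-1) P.
  apply/(stab N.-1); first lia.
  apply/(stab N.-2); first lia.
  rewrite pow_idI; apply/Ass_monP; first exact: idI_upset.
  exists [set x_; y_; z_]; split=> //; eexists; apply: witness_idI_xyz; lia.
rewrite pow_idI => /(Ass_monP _ (@idI_upset _ N0 _)) [S [PS W]].
move/meets_inj: PS => ES; move: W; rewrite -ES witE //.
by case=> /setP; [move/(_ z_) | move/(_ u_)]; rewrite !inE.
Qed.

Lemma astab_idJ : is_astab J 1.
Proof.
split=> // [k k0 P|[|[|a]]] //; rewrite !pow_idJ.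
apply: Ass_mon_iff; try exact: idJ_upset.
by move=> S; rewrite !witness_idJ.
Qed.

(** Without gaps the conditions on sums always hold, and the four inequalities describe (xy,
    zu)^(kn). *)
Lemma has_depth_idJ_large k : N.-1 <= k -> has_depth (pow_ideal J k) 2.
Proof.
move=> Nk; have k0 : 0 < k by lia.
have -> : pow_ideal J k = mon_ideal (pow_xy_zu (k * N.+1)).
  rewrite pow_idJ; congr mon_ideal; apply: pred_ext => m; rewrite /pow_xy_zu.
  split=> [[? ? [? _] [? _]]|mq]; first lia.
  split; try lia; split; try lia.
    case: (leqP (m x_) (k * N.+1)) => mx; last by left; lia.
    by right; apply: sums_full => //; lia.
  case: (leqP (m y_) (k * N.+1)) => my; last by left; lia.
  by right; apply: sums_full => //; lia.
by apply: has_depth_pow_xy_zu; rewrite muln_gt0 k0.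
Qed.

Lemma depth_idJ_gap : ~ has_depth (pow_ideal J N.-2) 2.
Proof.
rewrite pow_idJ => -[[s [rs s2]] _]; pose k := N.-2.
have kN : k.+1 < N by rewrite /k; lia.
have k0 : 0 < k by rewrite /k; lia.
have kkN : k.+1 <= k * N.+1 by nia.
have : size s < 2; last by rewrite s2.
(* The gap is k + 1. A factor x or z gives excess only to the degree in x, z, and a factor y or u
   only to that in y, u, so both kinds are required. *)
pose w := mon4 k.+1 k.+1 (k * N.+1 - k.+1) (k * N.+1 - k.+1).
apply: (disconnected_depth_lt2 (S := [set x_; z_]) (i := x_) (j := y_) (w := w)) rs.
- exact: idJ_upset.
- by rewrite !inE.
- by rewrite !inE.
- move=> i j; rewrite !inE; move: i j; apply: ord4P => //= j _;
  by move: j; apply: ord4P => //= _; rewrite /idJ !mnmDE !mnm1E !mon4E -/k /=;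
     split; try lia; split; try lia; left; lia.
- case=> _ _ _ []; rewrite !mnmDE !mnm1E !mon4E -/k /= !addn0 => _ [|]; first lia.
  exact: sums_gap.
- case=> _ _ [] + + _; rewrite !mnmDE !mnm1E !mon4E -/k /= !addn0 => _ [|]; first lia.
  exact: sums_gap.
Qed.

Lemma dstab_idJ : is_dstab J N.-1.
Proof.
split; first lia.
  by move=> k Nk d; rewrite !(has_depthE _ (has_depth_idJ_large _)).
move=> d d0 dN stab; apply: depth_idJ_gap.
apply/(stab N.-2); first lia.
apply/(stab N.-1); first lia.
exact: has_depth_idJ_large.
Qed.

End Stability.

Theorem theorem2p3 (K : fieldType) (c : nat) :
  exists (I J : {mpoly K[4]} -> Prop),
    is_monomial_ideal I /\ is_monomial_ideal J /\
    (exists aI dI, [/\ is_astab I aI, is_dstab I dI & (dI + c <= aI)%N]) /\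
    (exists aJ dJ, [/\ is_astab J aJ, is_dstab J dJ & (aJ + c <= dJ)%N]).
Proof.
(* The indices are then 1 and [N.-1], that is c + 2, and 2 < N holds even for c = 0. *)
pose N := c + 3; have N2 : 2 < N by rewrite /N; lia.
have N0 : 0 < N by lia.
exists (mon_ideal (idI N 1)), (mon_ideal (idJ N 1)).
split; first exact/mon_ideal_monomial/idI_upset.
split; first exact/mon_ideal_monomial/idJ_upset.
split.
  exists N.-1, 1; split; [exact: astab_idI | exact: dstab_idI | rewrite /N; lia].
exists 1, N.-1; split; [exact: astab_idJ | exact: dstab_idJ | rewrite /N; lia].
Qed.
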